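(* Given a regular inference function $\Psi:\mathcal{X}\times\Theta\to\mathbb{R}^q$, for all $\theta\in\Theta$ and all $z\in\mathcal{Z}$ we have: (i) $\Psi^I\sim l^I$, i.e. $\Psi^I$ and $l^I$ are equivalent; (ii) $\mathrm{span}\{\psi_i^I(\cdot;\theta,z):i=1,\dots,q\}=E(\theta,z)$; (iii) $J_{\Psi^I}(\theta,z)=J_{l^I}(\theta,z)$.
   Context: Setting. $\lambda$ is a $\sigma$-finite measure on a measurable space $(\mathcal{X},\mathcal{A})$; $\mathcal{P}^*=\{p(\cdot;\theta,z)=dP_{\theta z}/d\lambda:\theta\in\Theta,\ z\in\mathcal{Z}\}$ is a family of probability densities, $\Theta\subseteq\mathbb{R}^q$ is open, $\mathcal{Z}$ is an arbitrary set, $(\theta,z)\mapsto p(\cdot;\theta,z)$ is a bijection onto $\mathcal{P}^*$, and all densities are strictly positive. $L^2_0(P)$ is the space of $P$-square-integrable functions with $P$-mean zero; $\langle\cdot,\cdot\rangle_{\theta z}$ is the inner product of $L^2(P_{\theta z})$. The partial score function $l(\cdot;\theta,z)=\nabla_\theta p(\cdot;\theta,z)/p(\cdot;\theta,z)=(l_1,\dots,l_q)^T$ is well defined $\lambda$-a.e., $l_i(\cdot;\theta,z)\in L^2_0(P_{\theta z})$, and $l$ is presupposed to satisfy the regularity conditions listed under ''Regular inference function'' below (with $z$ as additional argument). Nuisance tangent space. For $\theta\in\Theta$ let $\mathcal{P}^*_\theta=\{p(\cdot;\theta,z):z\in\mathcal{Z}\}$. The nuisance tangent set $T^0_N(\theta,z)$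 is the set of $\nu\in L^2_0(P_{\theta z})$ for which there are a set $V\subseteq[0,\infty)$ containing $0$ and having $0$ as an accumulation point, a path $\{p_t\}_{t\in V}\subseteq\mathcal{P}^*_\theta$ and functions $\{r_t\}_{t\in V}\subseteq L^2(P_{\theta z})$ with $p_t=p+tp\nu+tpr_t$ for all $t\in V$, where $p=p(\cdot;\theta,z)$, and $\|r_t\|_{L^2(P_{\theta z})}\to0$ as $t\downarrow0$. $T_N(\theta,z)$ is the $L^2_0(P_{\theta z})$-closure of the linear span of $T_N^0(\theta,z)$, and $T_N^\perp(\theta,z)$ is its orthogonal complement in $L^2_0(P_{\theta z})$. The space $F_{IA}$. For $z,z_*\in\mathcal{Z}$, the $m$-parallel transport of $a\in L^2_0(P_{\theta z_*})$ from $z_*$ to $z$ is $\overset{(m)}{\Pi}{}_{z_*}^{z}a=\frac{p(\cdot;\theta,z_* )}{p(\cdot;\theta,z)}\,a$. Define $F_{IA}(\theta,z)=\{r\in T_N^\perp(\theta,z):\ \langle\overset{(m)}{\Pi}{}_{z_*}^{z}\nu_*,r\rangle_{\theta z}=0\ \text{for all } z_*\in\mathcal{Z},\ \nu_*\in T_N(\theta,z_* )\}$ (it is understood that the transported functions lie in $L^2(P_{\theta z})$, so that the inner products are defined). It is a closed subspace of $L^2_0(P_{\theta z})$, also written $F_{IA}(\theta)$. Regular inference function. $\Psi:\mathcal{X}\times\Theta\to\mathbb{R}^q$, measurable in $x$, with components $\psi_1,\dots,\psi_q$, is a regular inference function if for all $\theta\in\Theta$, $z\in\mathcal{Z}$,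 $i,j\in\{1,\dots,q\}$: $\psi_i(\cdot;\theta)\in L^2_0(P_{\theta z})$; $\partial\psi_i(\cdot;\theta)/\partial\theta_j$ exists almost everywhere; $\frac{\partial}{\partial\theta_j}\int\psi_i(x;\theta)p(x;\theta,z)\lambda(dx)=\int\frac{\partial}{\partial\theta_j}[\psi_i(x;\theta)p(x;\theta,z)]\lambda(dx)$; the $q\times q$ matrix with entries $\mathrm{E}_{\theta z}\{\partial\psi_i(\cdot;\theta)/\partial\theta_j\}$ is well defined and nonsingular; and $\mathrm{E}_{\theta z}\{\Psi(\cdot;\theta)\Psi^T(\cdot;\theta)\}$ is positive definite. Decomposition. The information score function $l^I(\cdot;\theta,z)$ has as $i$-th component $l^I_i$ the orthogonal projection in $L^2_0(P_{\theta z})$ of $l_i(\cdot;\theta,z)$ onto $F_{IA}(\theta)$. Let $E(\theta,z)=\mathrm{span}\{l^I_i(\cdot;\theta,z):i=1,\dots,q\}$. For a function $\Psi$ with components in $L^2_0(P_{\theta z})$, $\Psi^I(\cdot;\theta,z)$ has as $i$-th component $\psi_i^I$ the orthogonal projection of $\psi_i$ onto $E(\theta,z)$. Equivalence. Two functions $\Psi,\Phi:\mathcal{X}\times\Theta\times\mathcal{Z}\to\mathbb{R}^q$ are equivalent, $\Psi\sim\Phi$, if for each $(\theta,z)$ there is a full-rank $q\times q$ matrix $K(\theta,z)$, not depending on $x$, with $\Psi(x;\theta,z)=K(\theta,z)\Phi(x;\theta,z)$ for $P_{\theta z}$-almost all $x$. Godambe information. For a (quasi-)inference function $\Psi$ (a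 function of $x,\theta$ and possibly $z$) with components in $L^2_0(P_{\theta z})$, the (extended) sensitivity is the $q\times q$ matrix $S_\Psi(\theta,z)$ with $(i,j)$ entry $-\langle\psi^I_j,l^I_i\rangle_{\theta z}$; for regular inference functions it coincides with the matrix with $(i,j)$ entry $\mathrm{E}_{\theta z}\{\partial\psi_j/\partial\theta_i\}$. The variability is $V_\Psi(\theta,z)=\mathrm{E}_{\theta z}\{\Psi\Psi^T\}$, and the Godambe information is $J_\Psi(\theta,z)=S_\Psi(\theta,z)V_\Psi^{-1}(\theta,z)S_\Psi^T(\theta,z)$. *)

(* Defs.v *)
From HB Require Import structures.
From mathcomp Require Import all_boot all_order all_algebra.
From mathcomp Require Import all_classical all_reals all_analysis.

Set Implicit Arguments.
Unset Strict Implicit.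
Unset Printing Implicit Defensive.
Import Order.TTheory GRing.Theory Num.Theory.
Import numFieldNormedType.Exports.

Local Open Scope classical_set_scope.
Local Open Scope ring_scope.

(** Elements of L^2(mu) are represented by functions [X -> R] belonging to
    [Lfun mu 2%:E]; subspaces of L^2(mu) are sets of such functions that are
    saturated for equality mu-almost everywhere. *)
Section hilbert.
Context {d : measure_display} {X : measurableType d} {R : realType}.
Variable mu : probability X R.
Implicit Types (f g h : X -> R) (S F : set (X -> R)).

Definition inner f g : R := \int[mu]_x (f x * g x).

Definition L20 : set (X -> R) :=
  [set f | f \in Lfun mu 2%:E /\ \int[mu]_x f x = 0].

Definition L2span S : set (X -> R) :=
  [set f | f \in Lfun mu 2%:E /\
    exists (n : nat) (c : 'I_n -> R) (g : 'I_n -> X -> R),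
      (forall i, S (g i)) /\
      \forall x \ae mu, f x = \sum_(i < n) c i * g i x].

Definition L20closure S : set (X -> R) :=
  [set f | L20 f /\ forall e : R, 0 < e ->
    exists2 g, S g & (Lnorm mu 2%:E (EFin \o (f \- g)%R) < e%:E)%E].

Definition L20orth S : set (X -> R) :=
  [set f | L20 f /\ forall g, S g -> inner g f = 0].

Definition is_orthproj F f g := F g /\ forall h, F h -> inner (f \- g) h = 0.

(** A version of the orthogonal projection of [f] onto [F], which is determined
    only up to mu-almost everywhere equality. *)
Definition orthproj F f : X -> R := xget (cst 0) [set g | is_orthproj F f g].

End hilbert.

Definition posdefmx {R : realType} {q : nat} (A : 'M[R]_q) :=
  A^T = A /\ forall v : 'cV[R]_q, v != 0 -> 0 < (v^T *m A *m v) ord0 ord0.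

(** The j-th component of a vector-valued function on the sample space. *)
Definition component {X : Type} {R : realType} {q : nat}
  (f : X -> 'cV[R]_q) (j : 'I_q) : X -> R := fun x => f x j ord0.

Section semiparametric.
Context {d : measure_display} {X : measurableType d} {R : realType}.
Context {q : nat} {Z : Type}.
Variable lambda : {sigma_finite_measure set X -> \bar R}.
Variable Theta : set 'rV[R]_q.
(** Outside [Theta] the values of [P], [p], [l] and of inference functions are
    irrelevant. *)
Variable P : 'rV[R]_q -> Z -> probability X R.
Variable p : 'rV[R]_q -> Z -> X -> R.
Variable l : 'rV[R]_q -> Z -> X -> 'cV[R]_q.
Implicit Types (theta : 'rV[R]_q) (z : Z).

Let e (j : 'I_q) : 'rV[R]_q := delta_mx ord0 j.

(** [g] is a (measurable, integrable) version of the partial derivative in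
    direction [j] at [theta] of [t |-> f t x], which need only exist for almost
    all [x]. *)
Definition is_pderiv_version (mu : {measure set X -> \bar R})
    (f : 'rV[R]_q -> X -> R) theta (j : 'I_q) (g : X -> R) :=
  mu.-integrable setT (EFin \o g) /\
  \forall x \ae lambda, is_derive theta (e j) (fun t => f t x) (g x).

(** Regularity at nuisance parameter [z].  Almost everywhere equalities for
    [lambda] and for [P theta z] coincide since densities are positive. *)
Definition regular_at z (f : 'rV[R]_q -> X -> 'cV[R]_q) :=
  forall theta, Theta theta ->
  [/\ forall i, L20 (P theta z) (component (f theta) i),
      exists df : 'I_q -> 'I_q -> X -> R,
        (forall i j, is_pderiv_version (P theta z)
           (fun t => component (f t) i) theta j (df i j)) /\
        (\matrix_(i, j) \int[P theta z]_x df i j x) \in unitmx,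
      forall i j, exists dfp : X -> R,
        is_pderiv_version lambda
          (fun t x => component (f t) i x * p t z x) theta j dfp /\
        is_derive theta (e j)
          (fun t => \int[lambda]_x (component (f t) i x * p t z x))
          (\int[lambda]_x dfp x)
    & posdefmx (\matrix_(i, j) inner (P theta z)
        (component (f theta) i) (component (f theta) j)) ].

Definition regular_inference_function (Psi : 'rV[R]_q -> X -> 'cV[R]_q) :=
  forall z, regular_at z Psi.

(** A path in the submodel with [theta] fixed is given by [zt : R -> Z], of
    which only the restriction to [V] matters. *)
Definition nuisance_tangent_set theta z : set (X -> R) :=
  [set nu | L20 (P theta z) nu /\
    exists (V : set R) (zt : R -> Z) (r : R -> X -> R),
      [/\ V `<=` [set t | 0 <= t], V 0, limit_point V 0,
          forall t, V t -> r t \in Lfun (P theta z) 2%:E /\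
            \forall x \ae lambda,
              p theta (zt t) x = p theta z x + t * p theta z x * nu x
                                 + t * p theta z x * r t x
        & Lnorm (P theta z) 2%:E (EFin \o r t) @[t --> within V 0^'+] --> 0%E]].

Definition nuisance_tangent_space theta z : set (X -> R) :=
  L20closure (P theta z)
    (L2span (P theta z) (nuisance_tangent_set theta z)).

Definition mtransport theta zs z (a : X -> R) : X -> R :=
  fun x => p theta zs x / p theta z x * a x.

Definition F_IA theta z : set (X -> R) :=
  [set r | L20orth (P theta z) (nuisance_tangent_space theta z) r /\
    forall zs nus, nuisance_tangent_space theta zs nus ->
      inner (P theta z) (mtransport theta zs z nus) r = 0].

Record semiparametric_model : Prop := {
  model_open : open Theta ;
  model_measurable : forall theta z, Theta theta ->
    measurable_fun setT (p theta z) ;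
  model_positive : forall theta z, Theta theta -> forall x, 0 < p theta z x ;
  model_density : forall theta z, Theta theta -> forall A, measurable A ->
    P theta z A = (\int[lambda]_(x in A) (p theta z x)%:E)%E ;
  (** densities are identified up to lambda-null sets *)
  model_bijective : forall theta theta' z z', Theta theta -> Theta theta' ->
    (\forall x \ae lambda, p theta z x = p theta' z' x) ->
    theta = theta' /\ z = z' ;
  (** [l theta z] is a version of the partial score *)
  model_score : forall theta z, Theta theta -> \forall x \ae lambda,
    forall j, derivable (fun t => p t z x) theta (e j) /\
      component (l theta z) j x =
        'D_(e j) (fun t => p t z x) theta / p theta z x ;
  model_score_regular : forall z, regular_at z (fun theta => l theta z) ;
  (** makes the inner products defining [F_IA] well defined *)
  model_transport : forall theta zs z nus, Theta theta ->
    nuisance_tangent_space theta zs nus ->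
    mtransport theta zs z nus \in Lfun (P theta z) 2%:E }.

Definition info_score theta z : X -> 'cV[R]_q := fun x =>
  \col_i orthproj (P theta z) (F_IA theta z) (component (l theta z) i) x.

Definition component_span (f : 'rV[R]_q -> Z -> X -> 'cV[R]_q) theta z :
    set (X -> R) :=
  L2span (P theta z) (range (component (f theta z))).

Definition info_space : 'rV[R]_q -> Z -> set (X -> R) :=
  component_span info_score.

Implicit Types (f g : 'rV[R]_q -> Z -> X -> 'cV[R]_q).

Definition info_part f theta z : X -> 'cV[R]_q := fun x =>
  \col_i orthproj (P theta z) (info_space theta z)
           (component (f theta z) i) x.

Definition equivalent f g := forall theta z, Theta theta ->
  exists2 K : 'M[R]_q, \rank K = q &
    \forall x \ae P theta z, f theta z x = K *m g theta z x.

Definition sensitivity f theta z : 'M[R]_q :=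
  \matrix_(i, j) - inner (P theta z) (component (info_part f theta z) j)
                                     (component (info_score theta z) i).

Definition variability f theta z : 'M[R]_q :=
  \matrix_(i, j) inner (P theta z) (component (f theta z) i)
                                   (component (f theta z) j).

Definition godambe f theta z : 'M[R]_q :=
  sensitivity f theta z *m invmx (variability f theta z)
    *m (sensitivity f theta z)^T.

End semiparametric.

(* Main.v *)
Require Import Defs.
From HB Require Import structures.
From mathcomp Require Import all_boot all_order all_algebra.
From mathcomp Require Import all_classical all_reals all_analysis.
From mathcomp Require Import measurable_realfun ring lra.
Import Order.TTheory GRing.Theory Num.Theory.
Import numFieldNormedType.Exports.
Local Open Scope classical_set_scope.
Local Open Scope ring_scope.

(** A component [psi_i] of [Psi] does not depend on [z] and has mean zero under
    every [P theta z], so integrating it along a path of densities and dividing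
    by [t] shows that it is orthogonal to the nuisance tangent vectors at every
    [z], also after m-parallel transport; thus [psi_i] lies in [F_IA].
    Differentiating [E psi_i = 0] in [theta] gives
    [<psi_i, l_j> = - E (d psi_i / d theta_j)], and since [l_j - l^I_j] is
    orthogonal to [F_IA], the matrix [M = (<psi_i, l^I_j>)] is nonsingular.
    Hence so is the Gram matrix [G] of [l^I], the projection on [E] is explicit
    with [Psi^I = M G^-1 l^I], and every nonsingular linear transform of [l^I]
    has Godambe information [G].  That [l^I] exists at all is the Hilbert
    projection theorem, for which the completeness of [L^2] is needed. *)

Set Implicit Arguments.
Unset Strict Implicit.
Unset Printing Implicit Defensive.

(** * Elementary real bounds and integrals of almost everywhere equal functions *)

Lemma discriminant_le (R : realFieldType) (a b c : R) : 0 <= c ->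
  (forall t, 0 <= a - 2 * t * b + t ^+ 2 * c) -> b ^+ 2 <= a * c.
Proof.
rewrite le_eqVlt => /predU1P[<-|c0] h.
  have [->|b0] := eqVneq b 0; first by rewrite mulr0 expr0n.
  (* With [c = 0] the expression is affine in [t], and this [t] gives it the value [-1]. *)
  have := h ((a + 1) / (2 * b)); rewrite mulr0 addr0.
  have -> : 2 * ((a + 1) / (2 * b)) * b = a + 1 by field.
  by move=> ?; exfalso; lra.
(* The minimum of the quadratic is attained at [b / c]. *)
have := h (b / c).
have -> : a - 2 * (b / c) * b + (b / c) ^+ 2 * c = (a * c - b ^+ 2) / c.
  by field; rewrite gt_eqF.
by rewrite pmulr_lge0 ?invr_gt0// subr_ge0.
Qed.

(** It is applied to squares of inner products, where a bound by a multiple of [4^-1 ^+ k] for every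
    [k] forces orthogonality. *)
Lemma geometric_bound_eq0 (R : realType) (x C : R) :
  (forall k : nat, x <= C * 4^-1 ^+ k) -> x <= 0.
Proof.
move=> h; apply: (@cvgr_to_ge _ \oo _ _ (fun k => C * 4^-1 ^+ k)).
  rewrite -[X in _ --> X](mulr0 C); apply: cvgM; first exact: cvg_cst.
  by apply: cvg_expr; rewrite ger0_norm ?invr_ge0// invf_lt1// ltr1n.
by apply: nearW => k; exact: h.
Qed.

Lemma ae_Rintegral {d} {X : measurableType d} {R : realType}
    (mu : {measure set X -> \bar R}) (f g : X -> R) :
  measurable_fun setT f -> measurable_fun setT g ->
  (\forall x \ae mu, f x = g x) -> \int[mu]_x f x = \int[mu]_x g x.
Proof.
move=> mf mg fg; congr fine; apply: ae_eq_integral => //; try exact/measurable_EFinP.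
by apply: filterS fg => x /= ->.
Qed.

(** * The inner product on square-integrable functions *)

Section L2.
Context {d : measure_display} {X : measurableType d} {R : realType}.
Variable mu : probability X R.
Implicit Types (f g h : X -> R).
Local Notation L2 := (Lfun mu 2%:E).

Lemma L2_measurable f : f \in L2 -> measurable_fun setT f.
Proof. by rewrite inE => /andP[+ _]; rewrite inE. Qed.

Lemma L2P f : measurable_fun setT f ->
  mu.-integrable setT (fun x => (f x ^+ 2)%:E) -> f \in L2.
Proof.
move=> mf /integrableP[_ fi]; rewrite inE; apply/andP; split; rewrite inE//=.
rewrite /finite_norm unlock poweR_lty//; apply: le_lt_trans fi.
by under eq_integral do rewrite abse_EFin poweR_EFin powR_mulrn// -normrX -abse_EFin.
Qed.

Lemma L2_lin a f b g : f \in L2 -> g \in L2 ->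
  (fun x => a * f x + b * g x) \in L2.
Proof.
have [L20 Llin] := Lfun_submod_closed mu (lee1n 2).
move=> fL gL; apply: (Llin a f (b *: g)) => //.
by have := Llin b g 0 gL L20; rewrite addr0.
Qed.

Lemma L2D f g : f \in L2 -> g \in L2 -> (fun x => f x + g x) \in L2.
Proof.
move=> fL gL.
have -> : (fun x => f x + g x) = (fun x => 1 * f x + 1 * g x).
  by apply/funext => x; ring.
exact: L2_lin.
Qed.

Lemma L2B f g : f \in L2 -> g \in L2 -> (f \- g) \in L2.
Proof.
move=> fL gL.
have -> : (f \- g) = (fun x => 1 * f x + (-1) * g x).
  by apply/funext => x /=; ring.
exact: L2_lin.
Qed.

Lemma L2Z a f : f \in L2 -> (fun x => a * f x) \in L2.
Proof.
move=> fL; have -> : (fun x => a * f x) = (fun x => a * f x + 0 * f x).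
  by apply/funext => x; ring.
exact: L2_lin.
Qed.

Lemma L2_cst a : cst a \in L2. Proof. exact: Lfun_cst. Qed.

Lemma L2_sum n (c : 'I_n -> R) (g : 'I_n -> X -> R) :
  (forall i, g i \in L2) -> (fun x => \sum_(i < n) c i * g i x) \in L2.
Proof.
elim: n c g => [|n ih] c g gL.
  by under eq_fun do rewrite big_ord0; exact: L2_cst.
under eq_fun do rewrite big_ord_recl.
by apply: L2D; [exact: L2Z|exact: ih].
Qed.

Lemma L2_integrableM f g : f \in L2 -> g \in L2 ->
  mu.-integrable setT (fun x => (f x * g x)%:E).
Proof. by move=> fL gL; exact/Lfun1_integrable/Lfun2_mul_Lfun1. Qed.

Lemma L2_integrable f : f \in L2 -> mu.-integrable setT (fun x => (f x)%:E).
Proof.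
move=> fL; have := L2_integrableM fL (L2_cst 1).
by congr (_.-integrable _ _); apply/funext => x /=; rewrite mulr1.
Qed.

Lemma innerC f g : inner mu f g = inner mu g f.
Proof. by rewrite /inner; under eq_Rintegral do rewrite mulrC. Qed.

Lemma inner_linl a f b g h : f \in L2 -> g \in L2 -> h \in L2 ->
  inner mu (fun x => a * f x + b * g x) h = a * inner mu f h + b * inner mu g h.
Proof.
move=> fL gL hL; rewrite /inner -!RintegralZl//; try exact: L2_integrableM.
rewrite -RintegralD//.
- by apply: eq_Rintegral => x _; ring.
- by have := L2_integrableM (L2Z a fL) hL; congr (_.-integrable _ _);
    apply/funext=> x /=; rewrite mulrA.
- by have := L2_integrableM (L2Z b gL) hL; congr (_.-integrable _ _);
    apply/funext=> x /=; rewrite mulrA.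
Qed.

Lemma innerBl f g h : f \in L2 -> g \in L2 -> h \in L2 ->
  inner mu (f \- g) h = inner mu f h - inner mu g h.
Proof.
move=> fL gL hL; have := inner_linl 1 (-1) fL gL hL.
rewrite mul1r mulN1r => <-; congr inner; apply/funext => x /=; ring.
Qed.

Lemma inner_suml n (c : 'I_n -> R) (g : 'I_n -> X -> R) h :
  (forall i, g i \in L2) -> h \in L2 ->
  inner mu (fun x => \sum_(i < n) c i * g i x) h = \sum_(i < n) c i * inner mu (g i) h.
Proof.
move=> + hL; elim: n c g => [|n ih] c g gL.
  rewrite big_ord0 /inner; under eq_Rintegral do rewrite big_ord0 mul0r.
  by rewrite /Rintegral integral0.
rewrite big_ord_recl -ih//.
rewrite -[X in _ = _ + X]mul1r -inner_linl//; last exact: L2_sum.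
by congr inner; apply/funext => x; rewrite big_ord_recl mul1r.
Qed.

Lemma inner_ae f f' g g' :
  f \in L2 -> f' \in L2 -> g \in L2 -> g' \in L2 ->
  (\forall x \ae mu, f x = f' x) -> (\forall x \ae mu, g x = g' x) ->
  inner mu f g = inner mu f' g'.
Proof.
move=> fL f'L gL g'L ff gg; apply: ae_Rintegral.
- by apply: measurable_funM; exact: L2_measurable.
- by apply: measurable_funM; exact: L2_measurable.
- by apply: filterS2 ff gg => x -> ->.
Qed.

Lemma inner_ge0 f : 0 <= inner mu f f.
Proof. by apply: Rintegral_ge0 => x _; rewrite -expr2 sqr_ge0. Qed.

Lemma inner_eq0 f : f \in L2 -> inner mu f f = 0 -> \forall x \ae mu, f x = 0.
Proof.
move=> fL /eqP; have fi := L2_integrableM fL fL.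
rewrite /inner /Rintegral fine_eq0; last exact: integrable_fin_num.
move=> /eqP f0.
have : ae_eq mu setT (fun x => (f x * f x)%:E) (cst 0%E).
  apply/ae_eq_integral_abs => //; first exact: measurable_int fi.
  by rewrite -f0; apply: eq_integral => x _; rewrite gee0_abs// lee_fin -expr2 sqr_ge0.
by apply: filterS => x /(_ I) /= [] /eqP; rewrite mulf_eq0 orbb => /eqP.
Qed.

Lemma inner_lin_sqr a f b g : f \in L2 -> g \in L2 ->
  inner mu (fun x => a * f x + b * g x) (fun x => a * f x + b * g x) =
  a ^+ 2 * inner mu f f + 2 * a * b * inner mu f g + b ^+ 2 * inner mu g g.
Proof.
move=> fL gL; have kL := L2_lin a b fL gL.
rewrite inner_linl// [inner mu f _]innerC [inner mu g _]innerC.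
by rewrite (inner_linl _ _ fL gL fL) (inner_linl _ _ fL gL gL) (innerC g f); ring.
Qed.

Lemma innerBB t f g : f \in L2 -> g \in L2 ->
  inner mu (fun x => f x - t * g x) (fun x => f x - t * g x) =
  inner mu f f - 2 * t * inner mu f g + t ^+ 2 * inner mu g g.
Proof.
move=> fL gL.
have -> : (fun x => f x - t * g x) = (fun x => 1 * f x + (- t) * g x).
  by apply/funext => x; ring.
by rewrite inner_lin_sqr//; ring.
Qed.

(** Cauchy-Schwarz, from the nonnegativity of the squared norm of [f - t g] for all [t]. *)
Lemma inner_sqr_le f g : f \in L2 -> g \in L2 ->
  inner mu f g ^+ 2 <= inner mu f f * inner mu g g.
Proof.
move=> fL gL; apply: discriminant_le; first exact: inner_ge0.
by move=> t; rewrite -innerBB//; exact: inner_ge0.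
Qed.

Lemma Lnorm2E f : f \in L2 ->
  Lnorm mu 2%:E (EFin \o f) = (Num.sqrt (inner mu f f))%:E.
Proof.
move=> fL; rewrite -powR12_sqrt ?inner_ge0// -poweR_EFin unlock; congr (_ `^ _)%E.
rewrite /inner /Rintegral fineK; last exact/integrable_fin_num/L2_integrableM.
by apply: eq_integral => x _; rewrite abse_EFin poweR_EFin powR_mulrn// real_normK ?num_real.
Qed.

End L2.

(** * Completeness of L^2 and the Hilbert projection theorem *)

Section completeness.
Context {d : measure_display} {X : measurableType d} {R : realType}.
Variable mu : probability X R.
Implicit Types (f g h : X -> R).
Local Notation L2 := (Lfun mu 2%:E).

(** Hölder's inequality against the constant 1, whose norm is 1 under a probability measure. *)
Lemma L1_le_L2 f : f \in L2 ->
  (\int[mu]_x `|(f x)%:E| <= (Num.sqrt (inner mu f f))%:E)%E.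
Proof.
move=> fL; have mf := L2_measurable fL.
have := @hoelder _ _ _ mu f (cst 1) 2 2 mf (measurable_cst _).
have -> : Lnorm mu 2%:E (EFin \o cst 1) = 1%E.
  by rewrite [LHS]Lnorm_cst1 [X in (X `^ _)%E]probability_setT poweR1r.
rewrite mule1 Lnorm2E// Lnorm1.
have -> : f \* cst 1 = f by apply/funext => x /=; rewrite mulr1.
by apply; rewrite ?ltr0n//; lra.
Qed.

(** The telescoping series of [u] converges absolutely, hence converges, and its partial sums are
    [u n - u 0]. *)
Lemma cvg_of_summable_increments (u : R^nat) :
  (\sum_(0 <= n <oo) `|(u n.+1 - u n)%:E| < +oo)%E -> cvgn u.
Proof.
set s := (X in (X < _)%E) => soo.
have s0 : (0 <= s)%E by exact: nneseries_ge0.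
have : cvgn (series (telescope u)).
  apply: normed_cvg; apply: nondecreasing_is_cvgn.
    by apply: nondecreasing_series => n _ _ /=.
  exists (fine s) => _ [n _ <-].
  rewrite -lee_fin fineK ?ge0_fin_numE// /series/= -sumEFin.
  exact: (@nneseries_lim_ge _ (fun n => `|(u n.+1 - u n)%:E|%E)).
rewrite telescopeK => cu.
have -> : u = (fun n => [sequence u n - u 0%N]_n n + u 0%N).
  by apply/funext => n /=; rewrite subrK.
by apply: is_cvgD => //; exact: is_cvg_cst.
Qed.

Lemma limn_einf_le (v : (\bar R)^nat) (c : \bar R) :
  (forall n, (v n <= c)%E) -> (limn_einf v <= c)%E.
Proof.
move=> vc; rewrite limn_einf_lim; apply: lime_le; first exact: is_cvg_einfs.
apply: nearW => n; apply: le_trans (vc n).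
by apply: ereal_inf_lbound; exists n => /=.
Qed.

Section riesz_fischer.
Variable u : nat -> X -> R.
Hypothesis uL : forall n, u n \in L2.
Hypothesis uC : forall k n, (k <= n)%N ->
  inner mu (u n \- u k) (u n \- u k) <= 4^-1 ^+ k.

(** Consecutive terms are at L^2-distance, hence at L^1-distance, at most [2^-1 ^+ n]. The sum [S]
    of the absolute increments thus has integral at most 2 and is finite almost everywhere. *)
Lemma ae_cvg_of_fast_cauchy : \forall x \ae mu, cvgn (u ^~ x).
Proof.
pose F n x := `|(u n.+1 x - u n x)%:E|%E.
have mF n : measurable_fun setT (F n).
  apply: measurableT_comp => //; apply/measurable_EFinP.
  by apply: measurable_funB; exact: L2_measurable.
pose S x := (\sum_(0 <= n <oo) F n x)%E.
have F0 n x : (0 <= F n x)%E by exact: abse_ge0.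
have S0 x : (0 <= S x)%E by apply: nneseries_ge0 => *; exact: F0.
have mS : measurable_fun setT S by exact: ge0_emeasurable_sum.
have Soo : (\int[mu]_x S x < +oo)%E.
  rewrite integral_nneseries//; apply: (@le_lt_trans _ _ 2%:E); last by rewrite ltry.
  (* This series has terms [2 / 2 ^ n.+1], that is [2^-1 ^+ n], and sum at most 2. *)
  apply: le_trans (epsilon_trick0 xpredT (ler0n R 2)).
  apply: lee_nneseries => [n _ _|n _]; first exact: integral_ge0.
  apply: le_trans (L1_le_L2 (L2B (uL n.+1) (uL n))) _.
  have -> : 2 / (2 ^ n.+1)%:R = 2^-1 ^+ n :> R.
    by rewrite natrX exprS invfM mulrA divff// mul1r exprVn.
  rewrite lee_fin -[leRHS]ger0_norm ?exprn_ge0 ?invr_ge0// -sqrtr_sqr ler_sqrt ?sqr_ge0//.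
  apply: le_trans (uC (leqnSn n)) _.
  by rewrite -exprM mulnC exprM expr2 -invfM -natrM.
have : mu.-integrable setT S.
  by apply/integrableP; split => //; under eq_integral do rewrite gee0_abs//.
move/(integrable_ae measurableT); apply: filterS => x /(_ I) Sx.
apply: cvg_of_summable_increments.
by rewrite ltey_eq Sx.
Qed.

(** The increments of [u] are absolutely summable almost everywhere, which gives
    a pointwise limit; Fatou's lemma bounds its distance to each [u k]. *)
Lemma riesz_fischer : exists2 g, g \in L2 &
  forall k, inner mu (g \- u k) (g \- u k) <= 4^-1 ^+ k.
Proof.
have mun n : measurable_fun setT (u n) by exact: L2_measurable.
(* The limsup is measurable on all of [X] and agrees with the limit wherever that exists; [fine]
   sends infinite values to 0. *)
pose g x := fine (limn_esup (fun n => (u n x)%:E)).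
have mg : measurable_fun setT g.
  apply: measurableT_comp; first exact: fine_measurable.
  by apply: measurable_fun_limn_esup => n; exact/measurable_EFinP.
have gE : \forall x \ae mu, u n x @[n --> \oo] --> g x.
  apply: filterS ae_cvg_of_fast_cauchy => x cux.
  have cE : (u n x)%:E @[n --> \oo] --> (limn (u ^~ x))%:E.
    by apply: cvg_EFin => //; exact: nearW.
  have [_ eE] := cvg_limn_einf_sup cE.
  by rewrite /g eE.
have gk k : (\int[mu]_x ((g x - u k x) ^+ 2)%:E <= (4^-1 ^+ k)%:E)%E.
  (* The shift by [k] makes [uC] applicable to every term of the sequence. *)
  pose f n x := ((u (n + k)%N x - u k x) ^+ 2)%:E.
  have mf n : measurable_fun setT (f n).
    by apply/measurable_EFinP/measurable_funX/measurable_funB.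
  have f0 n x : (0 <= f n x)%E by rewrite lee_fin sqr_ge0.
  have -> : (\int[mu]_x ((g x - u k x) ^+ 2)%:E =
      \int[mu]_x (limn_einf (f ^~ x)))%E.
    apply: ae_eq_integral => //.
    - by apply/measurable_EFinP/measurable_funX/measurable_funB.
    - have -> : (fun x => limn_einf (f ^~ x)) =
          (fun x => - limn_esup (fun n => - f n x))%E.
        apply/funext => x; rewrite -limn_einfN; congr limn_einf.
        by apply/funext => n; exact/esym/oppeK.
      apply: measurableT_comp => //; apply: measurable_fun_limn_esup => n.
      exact: measurableT_comp.
    apply: filterS gE => x cx _; apply/esym.
    have : f n x @[n --> \oo] --> ((g x - u k x) ^+ 2)%:E.
      apply: cvg_EFin; first exact: nearW.
      apply: cvgM; apply: cvgB; try exact: cvg_cst.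
        by have := cx; rewrite -(cvg_shiftn k).
      by have := cx; rewrite -(cvg_shiftn k).
    by case/cvg_limn_einf_sup.
  apply: le_trans (fatou mu measurableT mf (fun n x _ => f0 n x)) _.
  apply: limn_einf_le => n.
  have := uC (leq_addl n k); rewrite -lee_fin; apply: le_trans.
  rewrite /inner /Rintegral fineK; last first.
    by apply: integrable_fin_num => //; apply: L2_integrableM; exact: L2B.
  by under [leRHS]eq_integral do rewrite -expr2.
have gkL k : (g \- u k) \in L2.
  apply: L2P; first exact: measurable_funB.
  apply/integrableP; split.
    by apply/measurable_EFinP/measurable_funX/measurable_funB.
  apply: le_lt_trans (ltry (4^-1 ^+ k)).
  under eq_integral do rewrite gee0_abs ?lee_fin ?sqr_ge0//.
  exact: gk.
exists g.
  have -> : g = (fun x => (g \- u 0%N) x + u 0%N x).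
    by apply/funext => x /=; rewrite subrK.
  exact: L2D.
move=> k; rewrite -lee_fin; apply: le_trans (gk k).
rewrite /inner /Rintegral fineK; last exact/integrable_fin_num/L2_integrableM.
by under eq_integral do rewrite -expr2.
Qed.

End riesz_fischer.

(** Projection is treated only for subspaces of this form: they are closed by Cauchy-Schwarz, and
    [F_IA] turns out to be one of them. *)
Definition orthocompl (S : set (X -> R)) : set (X -> R) :=
  [set r | r \in L2 /\ forall h, S h -> inner mu h r = 0].

Lemma orthocompl_lin S a f b g : S `<=` [set h | h \in L2] ->
  orthocompl S f -> orthocompl S g -> orthocompl S (fun x => a * f x + b * g x).
Proof.
move=> SL [fL fS] [gL gS]; split; first exact: L2_lin.
move=> h Sh; have hL := SL _ Sh.
by rewrite innerC inner_linl// !(innerC mu _ h) fS// gS// !mulr0 addr0.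
Qed.

(** The parallelogram identity makes a sequence of near-minimisers of the distance to [f] Cauchy.
    Its limit stays in the complement, and [f] minus the limit is orthogonal to it because
    perturbing a near-minimiser cannot bring it below the infimum. *)
Lemma orthoproj_exists (S : set (X -> R)) f : S `<=` [set h | h \in L2] ->
  f \in L2 -> exists g, is_orthproj mu (orthocompl S) f g.
Proof.
move=> SL fL; pose F := orthocompl S.
have FL g : F g -> g \in L2 by case.
have F0 : F (cst 0).
  split=> [|h /SL hL]; first exact: L2_cst.
  by rewrite /inner; under eq_Rintegral do rewrite mulr0; rewrite /Rintegral integral0.
pose D := [set inner mu (f \- g) (f \- g) | g in F].
have Dinf : has_inf D.
  split; first by exists (inner mu (f \- cst 0) (f \- cst 0)), (cst 0).
  by exists 0 => _ [g _ <-]; exact: inner_ge0.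
pose m := inf D.
have mle g : F g -> m <= inner mu (f \- g) (f \- g).
  by move=> Fg; apply: ge_inf; [exact: Dinf.2|exists g].
(* The parallelogram identity will bound the squared distance of [u n] and [u k] by
   [2 * (e k + e n)], at most [4 * e k], which is the rate [riesz_fischer] asks for. *)
pose e k : R := 4^-1 ^+ k / 4.
have e0 k : 0 < e k by rewrite divr_gt0// exprn_gt0// invr_gt0.
have e_le k n : (k <= n)%N -> e n <= e k.
  by move=> kn; rewrite ler_pM2r// ler_wiXn2l// ?invr_ge0// invf_le1// ler1n.
have /choice[u uP] k : exists g, F g /\ inner mu (f \- g) (f \- g) < m + e k.
  by have [_ [g Fg <-] gm] := inf_adherent (e0 k) Dinf; exists g.
have uF k : F (u k) by case: (uP k).
have uL k : u k \in L2 by exact: FL.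
have fuL k : f \- u k \in L2 by exact: L2B.
have uC k n : (k <= n)%N -> inner mu (u n \- u k) (u n \- u k) <= 4^-1 ^+ k.
  (* The midpoint of [u k] and [u n] lies in [F], so its squared distance to [f] is at least [m]. *)
  move=> kn; have := mle _ (orthocompl_lin 2^-1 2^-1 SL (uF k) (uF n)).
  have -> : f \- (fun x => 2^-1 * u k x + 2^-1 * u n x) =
      (fun x => 2^-1 * (f \- u k) x + 2^-1 * (f \- u n) x).
    by apply/funext => x /=; field.
  have -> : u n \- u k = (fun x => 1 * (f \- u k) x + (-1) * (f \- u n) x).
    by apply/funext => x /=; ring.
  rewrite !(inner_lin_sqr _ _ (fuL k) (fuL n)).
  have := (uP k).2; have := (uP n).2; have := e_le _ _ kn.
  have -> : 4^-1 ^+ k = 4 * e k by rewrite /e; field.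
  lra.
have [g gL gu] := riesz_fischer uL uC.
have guL k : g \- u k \in L2 by exact: L2B.
exists g; split.
  split=> // h Sh; have hL := SL _ Sh; apply/eqP; rewrite -sqrf_eq0.
  rewrite eq_le sqr_ge0 andbT; apply/(@geometric_bound_eq0 _ _ (inner mu h h)) => k.
  have -> : inner mu h g = inner mu (g \- u k) h.
    by rewrite innerBl// !(innerC mu _ h) (uF k).2// subr0.
  apply: le_trans (inner_sqr_le (guL k) hL) _.
  by rewrite mulrC ler_wpM2l// inner_ge0.
move=> h Fh; have hL := FL _ Fh.
(* [u k + t h] is no closer to [f] than the infimum, which [u k] nearly attains. *)
have fuh k : inner mu (f \- u k) h ^+ 2 <= e k * inner mu h h.
  apply: discriminant_le; first exact: inner_ge0.
  move=> t; have := mle _ (orthocompl_lin 1 t SL (uF k) Fh).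
  have -> : f \- (fun x => 1 * u k x + t * h x) = (fun x => (f \- u k) x - t * h x).
    by apply/funext => x /=; ring.
  rewrite innerBB//; have := (uP k).2; lra.
apply/eqP; rewrite -sqrf_eq0 eq_le sqr_ge0 andbT.
apply/(@geometric_bound_eq0 _ _ (4 * inner mu h h)) => k.
have -> : inner mu (f \- g) h = inner mu (f \- u k) h - inner mu (g \- u k) h.
  by rewrite !innerBl//; ring.
have := fuh k; have := inner_sqr_le (guL k) hL.
have : inner mu (g \- u k) (g \- u k) * inner mu h h <= 4^-1 ^+ k * inner mu h h.
  by rewrite ler_wpM2r// inner_ge0.
have -> : 4^-1 ^+ k = 4 * e k by rewrite /e; field.
have := mulr_ge0 (ltW (e0 k)) (inner_ge0 mu h).
set A := inner mu (f \- u k) h; set B := inner mu (g \- u k) h.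
(* With [H] for [inner mu h h], [A ^+ 2 <= e k * H] and [B ^+ 2 <= 4 * e k * H]. Hence
   [(A - B) ^+ 2 <= 2 * A ^+ 2 + 2 * B ^+ 2] is at most [10 * e k * H], within the target
   [16 * e k * H]. *)
have := sqr_ge0 (A + B).
have -> : (A + B) ^+ 2 = A ^+ 2 + 2 * (A * B) + B ^+ 2 by ring.
have -> : (A - B) ^+ 2 = A ^+ 2 - 2 * (A * B) + B ^+ 2 by ring.
lra.
Qed.

End completeness.

(** * Projection onto finite-dimensional spans through Gram matrices *)

Section gram.
Context {d : measure_display} {X : measurableType d} {R : realType}.
Variable mu : probability X R.
Implicit Types (f g h : X -> R) (S F : set (X -> R)).
Local Notation L2 := (Lfun mu 2%:E).

Lemma orthprojP F f :
  (exists g, is_orthproj mu F f g) -> is_orthproj mu F f (orthproj mu F f).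
Proof. exact: xgetPex. Qed.

(** Testing both residuals against [g - g'] shows that its norm vanishes. As [F] is an arbitrary
    set, membership of the difference is a hypothesis. *)
Lemma is_orthproj_ae F f g g' : F `<=` [set h | h \in L2] -> f \in L2 ->
  F (g \- g') -> is_orthproj mu F f g -> is_orthproj mu F f g' ->
  \forall x \ae mu, g x = g' x.
Proof.
move=> FL fL Fgg' [Fg gP] [Fg' g'P].
have gL := FL _ Fg; have g'L := FL _ Fg'; have ggL := FL _ Fgg'.
have : inner mu (g \- g') (g \- g') = 0.
  have -> : inner mu (g \- g') (g \- g') =
      inner mu (f \- g') (g \- g') - inner mu (f \- g) (g \- g').
    by rewrite !innerBl//; ring.
  by rewrite gP// g'P// subrr.
by move/(inner_eq0 ggL); apply: filterS => x /= /eqP; rewrite subr_eq0 => /eqP.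
Qed.

Lemma L2span_rangeP n (s : 'I_n -> X -> R) f :
  L2span mu (range s) f <-> f \in L2 /\
    exists c : 'I_n -> R, \forall x \ae mu, f x = \sum_(i < n) c i * s i x.
Proof.
split=> [[fL [m [c [g [gs fE]]]]]|[fL [c fE]]]; split=> //; last first.
  by exists n, c, s; split=> // i; exists i.
have /choice[k kE] i : exists j, s j = g i by have [j _ ?] := gs i; exists j.
(* A combination may repeat generators, so the coefficients belonging to the same [s j] are added
   up. *)
exists (fun j => \sum_(i < m | k i == j) c i).
apply: filterS fE => x ->; rewrite (partition_big k xpredT)//=.
apply: eq_bigr => j _; rewrite mulr_suml; apply: eq_bigr => i /eqP <-.
by rewrite kE.
Qed.

Section finite_family.
Variables (n : nat) (s : 'I_n -> X -> R).
Hypothesis sL : forall i, s i \in L2.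
Let E := L2span mu (range s).

Definition gram m p (f : 'I_m -> X -> R) (g : 'I_p -> X -> R) : 'M[R]_(m, p) :=
  \matrix_(i, j) inner mu (f i) (g j).

Lemma trmx_gram m p (f : 'I_m -> X -> R) (g : 'I_p -> X -> R) :
  (gram f g)^T = gram g f.
Proof. by apply/matrixP => i j; rewrite !mxE innerC. Qed.

Lemma gram_lin m p (K : 'M[R]_(m, n)) (f : 'I_m -> X -> R) (g : 'I_p -> X -> R) :
  (forall i, f i \in L2) -> (forall i, g i \in L2) ->
  (forall i, \forall x \ae mu, f i x = \sum_j K i j * s j x) ->
  gram f g = K *m gram s g.
Proof.
move=> fL gL fE; apply/matrixP => i j; rewrite !mxE.
rewrite (@inner_ae _ _ _ mu _ (fun x => \sum_j K i j * s j x) _ (g j))//.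
- by rewrite inner_suml//; apply: eq_bigr => k _; rewrite mxE.
- exact: L2_sum.
- exact: filterE.
Qed.

Lemma L2span_L2 : E `<=` [set h | h \in L2].
Proof. by move=> h []. Qed.

Lemma L2span_lin (c : 'I_n -> R) : E (fun x => \sum_(i < n) c i * s i x).
Proof.
apply/L2span_rangeP; split; first exact: L2_sum.
by exists c; exact: filterE.
Qed.

Lemma L2spanB f g : E f -> E g -> E (f \- g).
Proof.
move=> /L2span_rangeP[fL [b fE]] /L2span_rangeP[gL [c gE]].
apply/L2span_rangeP; split; first exact: L2B.
exists (fun i => b i - c i); apply: filterS2 fE gE => x /= -> ->.
by rewrite -sumrB; apply: eq_bigr => i _; rewrite mulrBl.
Qed.

Lemma orth_L2span f h : f \in L2 -> (forall i, inner mu f (s i) = 0) -> E h ->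
  inner mu f h = 0.
Proof.
move=> fL fs /L2span_rangeP[hL [c hE]].
rewrite innerC (@inner_ae _ _ _ mu _ (fun x => \sum_j c j * s j x) _ f)//.
- by rewrite inner_suml// big1// => i _; rewrite innerC fs mulr0.
- exact: L2_sum.
- exact: filterE.
Qed.

(** The hypothesis on [c] is the system of normal equations: the residual is orthogonal to each
    [s j], hence to the span. *)
Lemma is_orthproj_L2span f (c : 'rV[R]_n) : f \in L2 ->
  c *m gram s s = \row_j inner mu f (s j) ->
  is_orthproj mu E f (fun x => \sum_(i < n) c ord0 i * s i x).
Proof.
move=> fL cG; have kL : (fun x => \sum_(i < n) c ord0 i * s i x) \in L2 by exact: L2_sum.
split; first exact: L2span_lin.
move=> h; apply: orth_L2span; first exact: L2B.
move=> j; rewrite innerBl// inner_suml//.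
move/matrixP/(_ ord0 j): cG; rewrite !mxE => <-.
by apply/eqP; rewrite subr_eq0; apply/eqP/eq_bigr => i _; rewrite mxE.
Qed.

(** If [v] annihilates the Gram matrix of [s], the combination of the [s i] with coefficients [v]
    has norm zero, so it vanishes almost everywhere. Then [v] also annihilates [gram s psi], whose
    rows are free. *)
Lemma gram_unit m (psi : 'I_m -> X -> R) : (forall i, psi i \in L2) ->
  row_free (gram s psi) -> gram s s \in unitmx.
Proof.
move=> psiL /row_free_inj psi_inj; rewrite -row_free_unit; apply/inj_row_free => v vG.
pose f x := \sum_i v ord0 i * s i x.
have fL : f \in L2 by exact: L2_sum.
have gfE p (g : 'I_p -> X -> R) : (forall i, g i \in L2) ->
    gram (fun _ : 'I_1 => f) g = v *m gram s g.
  move=> gL; apply: gram_lin => // i; apply: filterE => x.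
  by rewrite (ord1 i).
have f0 : \forall x \ae mu, f x = 0.
  apply: inner_eq0 => //.
  rewrite (inner_suml _ sL fL) big1// => i _.
  have /matrixP/(_ ord0 i) := gfE _ _ sL; rewrite vG !mxE innerC => ->.
  by rewrite mulr0.
apply: psi_inj; rewrite mul0mx -gfE//; apply/matrixP => i j; rewrite !mxE.
rewrite (@inner_ae _ _ _ mu _ (cst 0) _ (psi j))//; last 2 first.
- exact: L2_cst.
- exact: filterE.
rewrite /inner; under eq_Rintegral do rewrite mul0r.
by rewrite /Rintegral integral0.
Qed.

Hypothesis G_unit : gram s s \in unitmx.

Lemma orthproj_L2spanP f : f \in L2 -> is_orthproj mu E f (orthproj mu E f).
Proof.
move=> fL; apply: orthprojP; eexists.
apply: (@is_orthproj_L2span f ((\row_j inner mu f (s j)) *m invmx (gram s s))) => //.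
by rewrite mulmxKV.
Qed.

Lemma orthproj_L2spanE p (f : 'I_p -> X -> R) i : (forall i, f i \in L2) ->
  \forall x \ae mu, orthproj mu E (f i) x =
    \sum_j (gram f s *m invmx (gram s s)) i j * s j x.
Proof.
move=> fL; have fP := orthproj_L2spanP (fL i).
have kP : is_orthproj mu E (f i) (fun x => \sum_j
    row i (gram f s *m invmx (gram s s)) ord0 j * s j x).
  apply: is_orthproj_L2span => //.
  rewrite -row_mul mulmxKV//; apply/rowP => j; by rewrite !mxE.
have := is_orthproj_ae L2span_L2 (fL i) (L2spanB fP.1 kP.1) fP kP.
apply: filterS => x ->; apply: eq_bigr => j _; by rewrite mxE.
Qed.

Lemma L2span_unitmx (K : 'M[R]_n) (f : 'I_n -> X -> R) : K \in unitmx ->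
  (forall i, \forall x \ae mu, f i x = \sum_j K i j * s j x) ->
  L2span mu (range f) = E.
Proof.
move=> Ku fE.
have fE' : \forall x \ae mu, forall i, f i x = \sum_j K i j * s j x.
  exact: filter_forall.
apply/seteqP; split => g /L2span_rangeP[gL [c gE]]; apply/L2span_rangeP; split => //.
  exists (fun j => \sum_i c i * K i j); apply: filterS2 gE fE' => x -> fx.
  under [RHS]eq_bigr do rewrite mulr_suml.
  rewrite exchange_big/=; apply: eq_bigr => i _; rewrite fx mulr_sumr.
  by apply: eq_bigr => j _; rewrite mulrA.
(* Conversely, inverting [K] pointwise expresses each [s i] through the [f j]. *)
exists (fun j => \sum_i c i * invmx K i j); apply: filterS2 gE fE' => x -> fx.
have {}fx : \col_i f i x = K *m \col_j s j x.
  by apply/colP => i; rewrite !mxE fx; apply: eq_bigr => j _; rewrite mxE.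
have /(congr1 (mulmx (invmx K))) := fx; rewrite mulKmx// => /esym sx.
have {}sx i : s i x = \sum_j invmx K i j * f j x.
  by move/colP/(_ i): sx; rewrite !mxE => ->; apply: eq_bigr => j _; rewrite mxE.
under [RHS]eq_bigr do rewrite mulr_suml.
rewrite exchange_big/=; apply: eq_bigr => i _; rewrite sx mulr_sumr.
by apply: eq_bigr => j _; rewrite mulrA.
Qed.

Lemma orthproj_L2span_id f : E f -> \forall x \ae mu, orthproj mu E f x = f x.
Proof.
move=> Ef; have fL := L2span_L2 Ef.
have fP := orthproj_L2spanP fL.
apply: (is_orthproj_ae L2span_L2 fL (L2spanB fP.1 Ef) fP).
split=> // h Eh; rewrite /inner.
under eq_Rintegral do rewrite /= subrr mul0r.
by rewrite /Rintegral integral0.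
Qed.

End finite_family.
End gram.

(** * Expectations as integrals against a density *)

Section density.
Context {d : measure_display} {X : measurableType d} {R : realType}.
Variables (lambda : {sigma_finite_measure set X -> \bar R}) (P : probability X R).
Variable p : X -> R.
Hypothesis mp : measurable_fun setT p.
Hypothesis Pp : forall A, measurable A -> P A = (\int[lambda]_(x in A) (p x)%:E)%E.

Lemma density_dominated : P `<< lambda.
Proof.
apply/null_content_dominatesP => A mA A0; rewrite Pp//.
apply: null_set_integral => //; apply/measurable_EFinP; exact: measurable_funTS.
Qed.

(** [p] and the Radon-Nikodym derivative of [P] have the same integral over every measurable set, so
    they agree [lambda]-almost everywhere. *)
Lemma Rintegral_density (f : X -> R) : measurable_fun setT f ->
  P.-integrable setT (EFin \o f) ->
  \int[P]_x f x = \int[lambda]_x (f x * p x).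
Proof.
move=> mf fi; have dom := density_dominated.
congr fine; rewrite -(Radon_Nikodym_change_of_variables dom measurableT fi).
have mep : measurable_fun setT (EFin \o p) by exact/measurable_EFinP.
apply: ae_eq_integral => //.
- apply: emeasurable_funM; [exact/measurable_EFinP|].
  by apply: measurable_int; exact: Radon_Nikodym_integrable.
- by apply/measurable_EFinP; exact: measurable_funM.
have : ae_eq lambda setT (Radon_Nikodym (charge_of_finite_measure P) lambda) (EFin \o p).
  apply: integral_ae_eq => //; first exact: Radon_Nikodym_integrable.
  by move=> A _ mA; rewrite -Radon_Nikodym_integral// -Pp.
by apply: filterS => x /(_ I) /= -> _; rewrite EFinM.
Qed.

End density.

(** * Orthogonality to spans, closures and limits *)

Section orthogonality.
Context {d : measure_display} {X : measurableType d} {R : realType}.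
Variable mu : probability X R.
Implicit Types (f g h : X -> R) (S : set (X -> R)).
Local Notation L2 := (Lfun mu 2%:E).

Lemma inner_sqr_le_Lnorm (e : R) f g : f \in L2 -> g \in L2 -> 0 < e ->
  (Lnorm mu 2%:E (EFin \o f) < e%:E)%E ->
  inner mu f g ^+ 2 <= inner mu g g * e ^+ 2.
Proof.
move=> fL gL e0; rewrite Lnorm2E// lte_fin => fe.
apply: le_trans (inner_sqr_le fL gL) _.
rewrite mulrC ler_wpM2l ?inner_ge0// -[leLHS]sqr_sqrtr ?inner_ge0//.
by rewrite ler_sqr ?nnegrE ?sqrtr_ge0// ltW.
Qed.

(** Cauchy-Schwarz for an [h] of norm below [2^-1 ^+ k] bounds the squared inner product by a
    multiple of [4^-1 ^+ k]. It serves both for closures and for the remainder of a path of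
    densities. *)
Lemma inner_eq0_approx f g : g \in L2 ->
  (forall e : R, 0 < e -> exists2 h, h \in L2 &
    inner mu f g = inner mu h g /\ (Lnorm mu 2%:E (EFin \o h) < e%:E)%E) ->
  inner mu f g = 0.
Proof.
move=> gL fh; apply/eqP; rewrite -sqrf_eq0 eq_le sqr_ge0 andbT.
apply/(@geometric_bound_eq0 _ _ (inner mu g g)) => k.
have e0 : 0 < 2^-1 ^+ k :> R by rewrite exprn_gt0// invr_gt0.
have [h hL [-> he]] := fh _ e0.
apply: le_trans (inner_sqr_le_Lnorm hL gL e0 he) _.
have -> : 4^-1 = 2^-1 ^+ 2 :> R by field.
by rewrite -!exprM mulnC.
Qed.

Lemma L2span_orth S g : S `<=` [set h | h \in L2] -> g \in L2 ->
  (forall h, S h -> inner mu h g = 0) ->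
  forall h, L2span mu S h -> inner mu h g = 0.
Proof.
move=> SL gL Sg h [hL [n [c [s [Ss hE]]]]].
have sL i : s i \in L2 by apply: SL; exact: Ss.
rewrite (@inner_ae _ _ _ mu _ (fun x => \sum_j c j * s j x) _ g)//.
- by rewrite inner_suml// big1// => i _; rewrite Sg// mulr0.
- exact: L2_sum.
- exact: filterE.
Qed.

Lemma L20closure_orth S g : S `<=` [set h | h \in L2] -> g \in L2 ->
  (forall h, S h -> inner mu h g = 0) ->
  forall h, L20closure mu S h -> inner mu h g = 0.
Proof.
move=> SL gL Sg h [[hL _] hS]; apply: inner_eq0_approx => // e e0.
have [k Sk hk] := hS e e0; have kL := SL _ Sk.
exists (h \- k); first exact: L2B.
by rewrite innerBl// (Sg k)// subr0.
Qed.

End orthogonality.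

(** * Unbiased functions, the space [F_IA] and the partial score *)

Section model.
Context {d : measure_display} {X : measurableType d} {R : realType}.
Context {q : nat} {Z : Type}.
Variable lambda : {sigma_finite_measure set X -> \bar R}.
Variable Theta : set 'rV[R]_q.
Variable P : 'rV[R]_q -> Z -> probability X R.
Variable p : 'rV[R]_q -> Z -> X -> R.
Variable l : 'rV[R]_q -> Z -> X -> 'cV[R]_q.
Hypothesis model : semiparametric_model lambda Theta P p l.

Section fixed_theta.
Variable theta : 'rV[R]_q.
Hypothesis Ttheta : Theta theta.

Let mp z : measurable_fun setT (p theta z).
Proof. exact: model_measurable model _ _ Ttheta. Qed.

Let p_gt0 z x : 0 < p theta z x.
Proof. exact: model_positive model _ _ Ttheta x. Qed.

Let Pp z A : measurable A ->
  P theta z A = (\int[lambda]_(x in A) (p theta z x)%:E)%E.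
Proof. exact: model_density model _ _ Ttheta A. Qed.

Let PE z (f : X -> R) : measurable_fun setT f ->
  (P theta z).-integrable setT (EFin \o f) ->
  \int[P theta z]_x f x = \int[lambda]_x (f x * p theta z x).
Proof. exact: (Rintegral_density (@mp z) (@Pp z)). Qed.

Lemma nuisance_tangent_set_orth z (psi nu : X -> R) :
  (forall z', L20 (P theta z') psi) ->
  nuisance_tangent_set lambda P p theta z nu -> inner (P theta z) nu psi = 0.
Proof.
move=> psi0 [[nuL _] [V [zt [r [Vge0 V0 Vlim Vr rto0]]]]].
have [psiL psiP] := psi0 z; have mpsi := L2_measurable psiL.
have mnu := L2_measurable nuL.
apply: inner_eq0_approx => // e e0.
have : \forall t \near within V 0^'+, (Lnorm (P theta z) 2%:E (EFin \o r t) < e%:E)%E.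
  have elt : nbhs (0%E : \bar R) [set y | (y < e%:E)%E].
    by apply: open_nbhs_nbhs; split; [exact: open_ereal_lt_ereal|rewrite /= lte_fin].
  exact: rto0 elt.
(* Since 0 is an accumulation point of [V], some nonzero [t] in [V] has a small remainder; it is
   positive, so division by [t] is possible. *)
move=> /Vlim[t [t0 Vt rte]].
have {}t0 : 0 < t by rewrite lt_neqAle eq_sym t0; exact: Vge0.
have {rte} : (Lnorm (P theta z) 2%:E (EFin \o r t) < e%:E)%E by exact: rte.
have [rL pE] := Vr _ Vt; have mr := L2_measurable rL => re.
(* The remainder with opposite sign has the same inner product with [psi] as [nu]. *)
exists (fun x => (-1) * r t x); first exact: L2Z.
split; last first.
  have -> : EFin \o (fun x => (-1) * r t x) = (\- (EFin \o r t))%E.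
    by apply/funext => x; rewrite /= mulN1r.
  by rewrite oppe_Lnorm.
(* [psi] has mean zero under both endpoints of the path, so
   [t <psi, nu> + t <psi, r t> = 0]. *)
have [psitL psitP] := psi0 (zt t).
have := psitP; rewrite PE//; last exact: L2_integrable.
(* Expanding the density at [zt t] along the path leaves the factor [p theta z], so the integral can
   be carried back to [P theta z]. *)
rewrite (@ae_Rintegral _ _ _ _ _
  (fun x => (psi x + t * (nu x * psi x + r t x * psi x)) * p theta z x)); last 3 first.
- exact: measurable_funM.
- apply: measurable_funM => //; apply: measurable_funD => //.
  by apply: measurable_funM => //; apply: measurable_funD; exact: measurable_funM.
- by apply: filterS pE => x ->; ring.
have nuI := L2_integrableM nuL psiL; have rI := L2_integrableM rL psiL.
have sI := integrableD measurableT nuI rI.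
have tI := integrableZl measurableT t sI.
rewrite -PE; last 2 first.
- apply: measurable_funD => //; apply: measurable_funM => //.
  by apply: measurable_funD; exact: measurable_funM.
- exact: (integrableD measurableT (L2_integrable psiL) tI).
rewrite RintegralD//; last exact: L2_integrable.
rewrite RintegralZl// RintegralD// psiP add0r => /eqP.
rewrite mulf_eq0 gt_eqF//= addr_eq0 => /eqP.
rewrite /inner => ->; under [in RHS]eq_Rintegral do rewrite -mulrA.
by rewrite RintegralZl// mulN1r.
Qed.

(* Being orthogonal to [cst 1] means having mean zero. *)
Let S z : set (X -> R) := [set h | [\/ h = cst 1,
  nuisance_tangent_space lambda P p theta z h | exists zs nus,
  nuisance_tangent_space lambda P p theta zs nus /\
  h = mtransport p theta zs z nus]].

(** This puts [F_IA] in the form for which [orthoproj_exists] yields projections; [model_transport]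
    supplies square-integrability of the transported vectors. *)
Lemma F_IA_orthocompl z : S z `<=` [set h | h \in Lfun (P theta z) 2%:E] /\
  F_IA lambda P p theta z = orthocompl (P theta z) (S z).
Proof.
split=> [h [->|[[]]//|[zs [nus [nusT ->]]]]|].
- exact: L2_cst.
- exact: (model_transport model z Ttheta nusT).
apply/seteqP; split=> [r [[[rL r0] rT] rtr]|r [rL rS]].
  split=> // h [->|/rT//|[zs [nus [nusT ->]]]]; last exact: rtr.
  by rewrite -[RHS]r0 /inner; apply: eq_Rintegral => x _; rewrite mul1r.
split=> [|zs nus nusT]; last by apply: rS; apply: Or33; exists zs, nus.
split=> [|g gT]; last by apply: rS; exact: Or32.
split=> //; rewrite -(rS (cst 1)); last exact: Or31.
by rewrite /inner; apply: eq_Rintegral => x _; rewrite mul1r.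
Qed.

Lemma F_IA_unbiased z (psi : X -> R) : (forall z', L20 (P theta z') psi) ->
  F_IA lambda P p theta z psi.
Proof.
move=> psi0; have psiL z' : psi \in Lfun (P theta z') 2%:E by have [] := psi0 z'.
have psiT z' nu : nuisance_tangent_space lambda P p theta z' nu ->
    inner (P theta z') nu psi = 0.
  apply: L20closure_orth => //; first by move=> h [].
  apply: L2span_orth => //; first by move=> h [[]].
  by move=> h; exact: nuisance_tangent_set_orth.
split; first by split; [exact: psi0|exact: psiT].
move=> zs nus nusT; have nusL : nus \in Lfun (P theta zs) 2%:E by case: nusT => [[]].
have trL := model_transport model z Ttheta nusT.
have mpsi := L2_measurable (psiL z).
(* Written as integrals against [lambda], the density ratio in the transport cancels [p theta z],
   leaving the inner product at [zs]. *)
rewrite -(psiT _ _ nusT) /inner !PE; last 4 first.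
- exact: (measurable_funM (L2_measurable nusL)).
- exact: L2_integrableM nusL _.
- exact: (measurable_funM (L2_measurable trL)).
- exact: L2_integrableM trL _.
apply: eq_Rintegral => x _; rewrite /mtransport; field.
by rewrite gt_eqF ?p_gt0.
Qed.

(** Differentiating the zero mean under the integral sign identifies this matrix with minus the
    expected Jacobian, which regularity makes nonsingular. *)
Lemma unbiased_score_gram z (Psi : 'rV[R]_q -> X -> 'cV[R]_q) :
  regular_at lambda Theta P p z Psi ->
  gram (P theta z) (component (Psi theta)) (component (l theta z)) \in unitmx.
Proof.
move=> Preg; have [PsiL [df [dfP Mu] dfpP _]] := Preg _ Ttheta.
have [lL _ _ _] := model_score_regular model z Ttheta.
suff -> : gram (P theta z) (component (Psi theta)) (component (l theta z)) =
    - \matrix_(i, j) \int[P theta z]_x df i j x by rewrite -scaleN1r unitmxZ ?unitrN1.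
apply/matrixP => i j; rewrite !mxE.
have [psiL _] := PsiL i; have [ljL _] := lL j.
have mpsi := L2_measurable psiL; have ml := L2_measurable ljL.
have [dfi dfE] := dfP i j.
have [dfp [[dfpi dfpE] dint]] := dfpP i j.
have mdf : measurable_fun setT (df i j).
  by apply/measurable_EFinP; exact: measurable_int dfi.
have mdfp : measurable_fun setT dfp.
  by apply/measurable_EFinP; exact: measurable_int dfpi.
(* [Theta] is open, so the mean is zero throughout a neighbourhood of [theta] and its derivative is
   that of a constant. *)
have int0 : \int[lambda]_x dfp x = 0.
  have /near_eq_is_derive : \forall t \near theta,
      \int[lambda]_x (component (Psi t) i x * p t z x) = 0.
    have := open_nbhs_nbhs (conj (model_open model) Ttheta).
    apply: filterS => t Tt; have [/(_ i)[tL t0] _ _ _] := Preg _ Tt.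
    rewrite -[RHS]t0; apply/esym/(Rintegral_density (p := p t z)) => //.
    - exact: model_measurable model _ _ Tt.
    - exact: model_density model _ _ Tt.
    - exact: L2_measurable tL.
    - exact: L2_integrable.
  move=> /(_ _ _ dint) => -[_ <-].
  exact: derive_cst.
(* The product rule, with the derivative of [p] written as score times [p]. *)
have dfpE' : \forall x \ae lambda, dfp x =
    (df i j x + component (Psi theta) i x * component (l theta z) j x) * p theta z x.
  apply: filterS3 (model_score model z Ttheta) dfE dfpE => x sx dx dpx.
  have [px lx] := sx j.
  have := is_deriveM dx (DeriveDef px (erefl _)).
  move=> [_ dE]; have [_ dpE] := dpx.
  rewrite -dpE [LHS]dE lx /GRing.scale/= /component.
  by field; rewrite gt_eqF ?p_gt0.
have := int0; rewrite (ae_Rintegral mdfp _ dfpE'); last first.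
  by apply: measurable_funM => //; apply: measurable_funD => //; exact: measurable_funM.
rewrite -PE; last 2 first.
- by apply: measurable_funD => //; exact: measurable_funM.
- exact: (integrableD measurableT dfi (L2_integrableM psiL ljL)).
rewrite RintegralD//; last exact: L2_integrableM.
by move=> /eqP; rewrite addr_eq0 => /eqP ->; rewrite opprK.
Qed.

End fixed_theta.
End model.

(** * The information score and Godambe information on its span *)

Section information.
Context {d : measure_display} {X : measurableType d} {R : realType}.
Context {q : nat} {Z : Type}.
Variable lambda : {sigma_finite_measure set X -> \bar R}.
Variable Theta : set 'rV[R]_q.
Variable P : 'rV[R]_q -> Z -> probability X R.
Variable p : 'rV[R]_q -> Z -> X -> R.
Variable l : 'rV[R]_q -> Z -> X -> 'cV[R]_q.
Hypothesis model : semiparametric_model lambda Theta P p l.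
Variables (theta : 'rV[R]_q) (z : Z).
Hypothesis Ttheta : Theta theta.

Let lI := info_score lambda P p l.
Let s : 'I_q -> X -> R := component (lI theta z).

(** As the projection exists, the choice in [orthproj] is a genuine projection and not the default
    0. *)
Lemma info_scoreP i : is_orthproj (P theta z) (F_IA lambda P p theta z)
  (component (l theta z) i) (s i).
Proof.
have -> : s i = orthproj (P theta z) (F_IA lambda P p theta z) (component (l theta z) i).
  by apply/funext => x; rewrite /s /component mxE.
have [SL ->] := F_IA_orthocompl model Ttheta z.
have [/(_ i)[lL _] _ _ _] := model_score_regular model z Ttheta.
exact/orthprojP/orthoproj_exists.
Qed.

Lemma info_score_L2 i : s i \in Lfun (P theta z) 2%:E.
Proof. by have [[[[]]]] := info_scoreP i. Qed.

(** The components of [Psi] lie in [F_IA], to which [l - l^I] is orthogonal, so replacing [l] by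
    [l^I] leaves the matrix unchanged. *)
Lemma unbiased_info_score_gram (Psi : 'rV[R]_q -> X -> 'cV[R]_q) :
  regular_inference_function lambda Theta P p Psi ->
  gram (P theta z) (component (Psi theta)) s \in unitmx.
Proof.
move=> Preg; have := unbiased_score_gram model Ttheta (Preg z).
congr (_ \in unitmx); apply/matrixP => i j; rewrite !mxE.
have psi0 z' : L20 (P theta z') (component (Psi theta) i).
  by have [/(_ i)] := Preg z' _ Ttheta.
have [psiL _] := psi0 z.
have [/(_ j)[lL _] _ _ _] := model_score_regular model z Ttheta.
have := (info_scoreP j).2 _ (F_IA_unbiased model Ttheta z psi0).
rewrite innerBl//; last exact: info_score_L2.
by move/eqP; rewrite subr_eq0 => /eqP H; rewrite innerC H innerC.
Qed.

Lemma godambe_info_space (f : 'rV[R]_q -> Z -> X -> 'cV[R]_q) (K : 'M[R]_q) :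
  gram (P theta z) s s \in unitmx -> K \in unitmx ->
  (forall i, component (f theta z) i \in Lfun (P theta z) 2%:E) ->
  (forall i, \forall x \ae P theta z,
    component (f theta z) i x = \sum_j K i j * s j x) ->
  godambe lambda P p l f theta z = gram (P theta z) s s.
Proof.
move=> Gu Ku fL fE; have sL := info_score_L2.
(* [V = K G K^T] and [S = - G K^T], so that [S V^-1 S^T = G]. *)
pose G := gram (P theta z) s s.
have VE : variability P f theta z = K *m G *m K^T.
  transitivity (gram (P theta z) (component (f theta z)) (component (f theta z))).
    by apply/matrixP => i j; rewrite !mxE.
  rewrite (gram_lin sL fL fL fE) -[gram _ s _]trmx_gram.
  by rewrite (gram_lin sL fL sL fE) trmx_mul trmx_gram mulmxA.
have SE : sensitivity lambda P p l f theta z = - (G *m K^T).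
  have -> : G *m K^T = (gram (P theta z) (component (f theta z)) s)^T.
    by rewrite (gram_lin sL fL sL fE) trmx_mul trmx_gram.
  apply/matrixP => i j; rewrite !mxE; congr (- _).
  (* The components of [f] already lie in the span of [s], so projecting onto it changes them only
     on a null set. *)
  have Ef : L2span (P theta z) (range s) (component (f theta z) j).
    by apply/L2span_rangeP; split=> //; exists (K j).
  have -> : component (info_part lambda P p l f theta z) j =
      orthproj (P theta z) (L2span (P theta z) (range s)) (component (f theta z) j).
    by apply/funext => x; rewrite /component mxE.
  apply: inner_ae => //; last exact: filterE.
    by have [[]] := orthproj_L2spanP sL Gu (fL j).
  exact: orthproj_L2span_id.
rewrite /godambe VE SE linearN/= trmx_mul trmxK trmx_gram mulNmx mulmxN mulNmx opprK.
rewrite -/G -(mulmxA K G); set A := G *m K^T.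
have KAu : K *m A \in unitmx by rewrite !unitmx_mul unitmx_tr Ku andbT.
(* A left inverse of a square matrix is a right inverse, so [A *m invmx (K *m A) *m K] is the
   identity and only [G] remains. *)
have /mulmx1C AK : invmx (K *m A) *m K *m A = 1%:M by rewrite -mulmxA mulVmx.
by rewrite mulmxA -[A *m _ *m K]mulmxA AK mul1mx.
Qed.

End information.

(** * The three claims, read off from one nonsingular relation *)

Unset Implicit Arguments.

Theorem proposition16 (d : measure_display) (X : measurableType d)
  (R : realType) (q : nat) (Z : Type)
  (lambda : {sigma_finite_measure set X -> \bar R})
  (Theta : set 'rV[R]_q)
  (P : 'rV[R]_q -> Z -> probability X R)
  (p : 'rV[R]_q -> Z -> X -> R)
  (l : 'rV[R]_q -> Z -> X -> 'cV[R]_q)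
  (model : semiparametric_model lambda Theta P p l)
  (Psi : 'rV[R]_q -> X -> 'cV[R]_q)
  (regular_Psi : regular_inference_function lambda Theta P p Psi) :
  let lI := info_score lambda P p l in
  let PsiI := info_part lambda P p l (fun theta _ => Psi theta) in
  equivalent Theta P PsiI lI /\
  forall (theta : 'rV[R]_q) (z : Z), Theta theta ->
    component_span P PsiI theta z = info_space lambda P p l theta z /\
    godambe lambda P p l PsiI theta z = godambe lambda P p l lI theta z.
Proof.
move=> lI PsiI.
(* Everything follows from [Psi^I = K l^I] with [K] nonsingular, together with the invertibility of
   the Gram matrix of [l^I]. *)
have key theta z : Theta theta ->
    let s := component (lI theta z) in
    gram (P theta z) s s \in unitmx /\ exists2 K : 'M[R]_q, K \in unitmx &
    forall i, component (PsiI theta z) i \in Lfun (P theta z) 2%:E /\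
      \forall x \ae P theta z, component (PsiI theta z) i x = \sum_j K i j * s j x.
  move=> Ttheta s; have sL : forall i, s i \in _ := info_score_L2 model z Ttheta.
  have PsiL i : component (Psi theta) i \in Lfun (P theta z) 2%:E.
    by have [/(_ i)[]] := regular_Psi z _ Ttheta.
  have Mu := unbiased_info_score_gram model z Ttheta regular_Psi.
  have Gu : gram (P theta z) s s \in unitmx.
    apply: (gram_unit sL PsiL).
    by rewrite row_free_unit -trmx_gram unitmx_tr.
  split=> //; exists (gram (P theta z) (component (Psi theta)) s *m
    invmx (gram (P theta z) s s)).
    by rewrite unitmx_mul Mu unitmx_inv.
  move=> i; have -> : component (PsiI theta z) i = orthproj (P theta z)
      (L2span (P theta z) (range s)) (component (Psi theta) i).
    by apply/funext => x; rewrite /component mxE.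
  split; first by have [[]] := orthproj_L2spanP sL Gu (PsiL i).
  exact: orthproj_L2spanE.
split=> [theta z /(key _ z)[_ [K Ku KE]]|theta z Ttheta].
  exists K; first exact: mxrank_unit.
  have : \forall x \ae P theta z, forall i,
      component (PsiI theta z) i x = \sum_j K i j * component (lI theta z) j x.
    by apply: filter_forall => i; case: (KE i).
  apply: filterS => x xE; apply/colP => i; rewrite [LHS]xE mxE.
  exact: eq_bigr.
have [Gu [K Ku KE]] := key _ z Ttheta; split.
  by apply: (L2span_unitmx Ku) => i; case: (KE i).
rewrite (godambe_info_space model Ttheta Gu Ku); try by move=> i; case: (KE i).
(* [l^I] itself is the case where [K] is the identity. *)
rewrite (godambe_info_space model Ttheta Gu (unitmx1 _ _))//.
  exact: (info_score_L2 model z Ttheta).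
move=> i; apply: filterE => x; rewrite (bigD1 i)//= mxE eqxx mul1r big1 ?addr0//.
by move=> j /negPf ji; rewrite mxE eq_sym ji mul0r.
Qed.
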